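(* For every code $\nu:\mathrm E$ and every point $x:\Delta\nu$, (1) if $\ell_\nu(x)=0$ then $\iota_\nu\,x$ is isolated in $\mathrm K\nu$; (2) if $\ell_\nu(x)=1$ then $\iota_\nu\,x$ is a limit point of $\mathrm K\nu$; (3) every point in the image of $\iota_\nu$ is either isolated or a limit point; (4) if $\neg\mathrm{WLPO}$ holds, then isolatedness of $\iota_\nu\,x$ is decidable.
   Context: Foundation: intensional Martin-Löf type theory as in the HoTT Book, with $\mathbf 0$, $\mathbf 1$ (point $\star$), $\mathbf 2$ (points $0,1$), $\mathbb N$, $+$, $\Pi$, $\Sigma$, universes, univalence (hence function extensionality), propositional truncation, set quotients, and inductive-recursive definitions. No excluded middle is assumed. $f^{-1}(y):=\Sigma_x(f\,x=y)$; an embedding is a map all of whose fibers are propositions (types with at most one element). A type $X$ is decidable if $X+\neg X$. A point $x:X$ is isolated if $x=y$ is decidable for every $y:X$. $\mathrm{WLPO}$ says that for every $p:\mathbb N\to\mathbf 2$ the type $\prod_{n}p\,n=1$ is decidable. A point $x:X$ is a limit point if ($x$ is isolated) $\to\mathrm{WLPO}$. Ordinals. An ordinal is a type with a proposition-valued, transitive, extensional (elements with the same predecessors are equal), well-founded relation $<$; the same symbol denotes an ordinal and its underlying type. $\mathbf 1$ is an ordinal with the empty order. A topped ordinal is an ordinal with a specified point $t$ such that $\neg(t<y)$ for all $y$; $\mathrm{Ord}^\top$ is their type. For a topped ordinal $\tau$ and $\upsilon:\tau\to\mathrm{Ord}^\top$, $\Sigma_\tau\upsilon$ is the topped ordinal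 $\Sigma_{x:\tau}\upsilon\,x$ with the lexicographic order: $(x,a)<(x',a')$ iff $x<x'$, or there is $r:x=x'$ such that the transport of $a$ along $r$ is below $a'$; its top is the pair of tops. The sum $\tau+\upsilon$ of topped ordinals is the lexicographic sum, over the two-point topped ordinal with underlying type $\mathbf 1+\mathbf 1$ and $\mathrm{inl}\,\star<\mathrm{inr}\,\star$, of the family with members $\tau,\upsilon$; its points are pairs $(\mathrm{inl}\,\star,x)$ or $(\mathrm{inr}\,\star,y)$. The topped ordinal $\omega+\mathbf 1$ is $\mathbb N+\mathbf 1$ with the usual order on $\mathbb N$ and the added point as top, above all $\mathrm{inl}\,n$. Conaturals: $\mathbb N_\infty:=\Sigma_{u:\mathbf 2^{\mathbb N}}\prod_i u_{i+1}\le u_i$; $\underline n$ is $n$ ones followed by zeros; $\infty$ is constantly $1$. It is a topped ordinal with top $\infty$ under $u<v:\equiv\Sigma_{n:\mathbb N}(u=\underline n)\times(v_n=1)$. $\iota_1:\mathbb N+\mathbf 1\hookrightarrow\mathbb N_\infty$ sends $\mathrm{inl}\,n$ to $\underline n$ and the added point to $\infty$. Extension: for an embedding $j:X\hookrightarrow K$ and $\alpha:X\to\mathrm{Ord}^\top$, $(\alpha/j)\,k:=\prod_{(x,p):j^{-1}(k)}\alpha\,x$ with order $u<v:\equiv\Sigma_{p:j^{-1}(k)}\,u\,p<v\,p$ and top the function assigning tops. Evaluation at $(x,\mathrm{refl})$ is an order equivalence $(\alpha/j)(j\,x)\simeq\alpha\,x$. Codes. $\mathrm E$ and $\Delta:\mathrm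 E\to\mathrm{Ord}^\top$ are defined simultaneously by induction-recursion. Constructors of $\mathrm E$: $\ulcorner\mathbf 1\urcorner$; $\ulcorner\omega+\mathbf 1\urcorner$; $\nu_0\,\ulcorner+\urcorner\,\nu_1$ and $\nu_0\,\ulcorner\times\urcorner\,\nu_1$ for $\nu_0,\nu_1:\mathrm E$; $\ulcorner\Sigma\urcorner\,\nu\,A$ for $\nu:\mathrm E$ and $A:\Delta\nu\to\mathrm E$. $\Delta\ulcorner\mathbf 1\urcorner=\mathbf 1$; $\Delta\ulcorner\omega+\mathbf 1\urcorner=\omega+\mathbf 1$; $\Delta(\nu_0\,\ulcorner+\urcorner\,\nu_1)=\Delta\nu_0+\Delta\nu_1$; $\Delta(\nu_0\,\ulcorner\times\urcorner\,\nu_1)=\Sigma_{\Delta\nu_0}(\lambda\_.\,\Delta\nu_1)$; $\Delta(\ulcorner\Sigma\urcorner\,\nu\,A)=\Sigma_{\Delta\nu}(\Delta\circ A)$. Simultaneously by induction on codes one defines $\mathrm K:\mathrm E\to\mathrm{Ord}^\top$ and $\iota_\nu:\Delta\nu\to\mathrm K\nu$ and proves that $\iota_\nu$ is an embedding: $\mathrm K\ulcorner\mathbf 1\urcorner=\mathbf 1$; $\mathrm K\ulcorner\omega+\mathbf 1\urcorner=\mathbb N_\infty$; $\mathrm K(\nu_0\,\ulcorner+\urcorner\,\nu_1)=\mathrm K\nu_0+\mathrm K\nu_1$; $\mathrm K(\nu_0\,\ulcorner\times\urcorner\,\nu_1)=\Sigma_{\mathrm K\nu_0}(\lambda\_.\,\mathrm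 K\nu_1)$; $\mathrm K(\ulcorner\Sigma\urcorner\,\nu\,A)=\Sigma_{\mathrm K\nu}\big((\mathrm K\circ A)/\iota_\nu\big)$; and $\iota_{\ulcorner\mathbf 1\urcorner}=\mathrm{id}$; $\iota_{\ulcorner\omega+\mathbf 1\urcorner}=\iota_1$; $\iota_{\nu_0\ulcorner+\urcorner\nu_1}(\mathrm{inl}\,\star,y)=(\mathrm{inl}\,\star,\iota_{\nu_0}y)$, $\iota_{\nu_0\ulcorner+\urcorner\nu_1}(\mathrm{inr}\,\star,y)=(\mathrm{inr}\,\star,\iota_{\nu_1}y)$; $\iota_{\nu_0\ulcorner\times\urcorner\nu_1}(x,y)=(\iota_{\nu_0}x,\iota_{\nu_1}y)$; $\iota_{\ulcorner\Sigma\urcorner\nu A}(x,z)=(\iota_\nu x,\varphi_x^{-1}(\iota_{A\,x}z))$, where $\varphi_x:((\mathrm K\circ A)/\iota_\nu)(\iota_\nu x)\simeq\mathrm K(A\,x)$ is evaluation at $(x,\mathrm{refl})$. Limit point indicator $\ell_\nu:\Delta\nu\to\mathbf 2$, by induction on $\nu$: $\ell_{\ulcorner\mathbf 1\urcorner}(\star)=0$; $\ell_{\ulcorner\omega+\mathbf 1\urcorner}(\mathrm{inl}\,n)=0$; $\ell_{\ulcorner\omega+\mathbf 1\urcorner}(\mathrm{inr}\,\star)=1$; $\ell_{\nu_0\ulcorner+\urcorner\nu_1}(\mathrm{inl}\,\star,x_0)=\ell_{\nu_0}(x_0)$; $\ell_{\nu_0\ulcorner+\urcorner\nu_1}(\mathrm{inr}\,\star,x_1)=\ell_{\nu_1}(x_1)$;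 $\ell_{\nu_0\ulcorner\times\urcorner\nu_1}(x_0,x_1)=\max(\ell_{\nu_0}(x_0),\ell_{\nu_1}(x_1))$; $\ell_{\ulcorner\Sigma\urcorner\nu A}(x,y)=\max(\ell_\nu(x),\ell_{A\,x}(y))$. *)

(* Defs.v *)
From Stdlib Require Import Bool Arith Lia FunctionalExtensionality.

(** Conventions.  [Type] is the universe of types, [=] the identity type and
    [Type]-valued [*], [+], [{x : X & P x}] are the (untruncated) logical
    connectives.  Neither proof irrelevance nor uniqueness of identity proofs
    nor excluded middle is used; the only axiom used is function
    extensionality.  In [bool], [false] is 0 and [true] is 1. *)

(** * Types *)

Definition is_prop (X : Type) : Type := forall x y : X, x = y.

Definition is_set (X : Type) : Type := forall x y : X, is_prop (x = y).

Definition fiber {X Y : Type} (f : X -> Y) (y : Y) : Type := {x : X | f x = y}.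

Definition is_embedding {X Y : Type} (f : X -> Y) : Type :=
  forall y : Y, is_prop (fiber f y).

(* Propositional truncation in its impredicative encoding, with the expected
   elimination principle for the propositions of the universe. *)
Definition trunc (X : Type) : Type :=
  forall P : Type, is_prop P -> (X -> P) -> P.

Definition in_image {X Y : Type} (f : X -> Y) (y : Y) : Type :=
  trunc (fiber f y).

Definition decidable (X : Type) : Type := (X + (X -> False))%type.

Definition isolated {X : Type} (x : X) : Type := forall y : X, decidable (x = y).

Definition WLPO : Type :=
  forall p : nat -> bool, decidable (forall n, p n = true).

Definition limit_point {X : Type} (x : X) : Type := isolated x -> WLPO.

Lemma trunc_in {X : Type} (x : X) : trunc X.
Proof. exact (fun _ _ f => f x). Qed.

Lemma trunc_is_prop (X : Type) : is_prop (trunc X).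
Proof.
  intros f g; extensionality P; extensionality h; extensionality k; apply h.
Qed.

Lemma embedding_in_image {X Y : Type} (f : X -> Y) (hf : is_embedding f) (y : Y) :
  in_image f y -> fiber f y.
Proof. exact (fun h => h (fiber f y) (hf y) (fun p => p)). Qed.

Lemma is_set_of_rel (X : Type) (R : X -> X -> Type)
  (R_prop : forall x y, is_prop (R x y)) (R_refl : forall x, R x x)
  (R_eq : forall x y, R x y -> x = y) : is_set X.
Proof.
  intros x y.
  set (g := fun (y : X) (p : x = y) =>
    R_eq x y (eq_rect x (fun z => R x z) (R_refl x) y p)).
  assert (H : forall z (p : x = z),
             p = eq_trans (eq_sym (g x eq_refl)) (g z p)).
  { intros z p; destruct p; symmetry; apply eq_trans_sym_inv_l. }
  intros p q; rewrite (H y p), (H y q); unfold g.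
  now rewrite (R_prop x y (eq_rect x (fun z => R x z) (R_refl x) y p)
                 (eq_rect x (fun z => R x z) (R_refl x) y q)).
Qed.

Lemma is_set_of_prop (X : Type) (h : is_prop X) : is_set X.
Proof.
  apply (is_set_of_rel X (fun _ _ => unit)); [| constructor | intros; apply h].
  now intros _ _ [] [].
Qed.

Lemma is_set_bool : is_set bool.
Proof.
  apply (is_set_of_rel bool (fun b c => if b then (if c then unit else Empty_set)
                                     else (if c then Empty_set else unit))).
  - now intros [] [] [] [].
  - intros []; exact tt.
  - now intros [] [].
Qed.

Lemma sig_eq {X : Type} {P : X -> Prop} (hP : forall x, is_prop (P x))
  (a b : {x : X | P x}) : proj1_sig a = proj1_sig b -> a = b.
Proof.
  destruct a as [x p], b as [y q]; simpl; intros r; destruct r.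
  now destruct (hP x p q).
Qed.

Lemma sigT_eq {X : Type} {P : X -> Type} (hP : forall x, is_prop (P x))
  (a b : {x : X & P x}) : projT1 a = projT1 b -> a = b.
Proof.
  destruct a as [x p], b as [y q]; simpl; intros r; destruct r.
  now destruct (hP x p q).
Qed.

Lemma pair2_inj {X : Type} {P : X -> Type} (hX : is_set X) {x : X} {a b : P x} :
  existT P x a = existT P x b -> a = b.
Proof.
  intros q.
  assert (H : forall (u v : {x : X & P x}) (r : u = v),
    eq_rect (projT1 u) P (projT2 u) (projT1 v) (f_equal (@projT1 _ _) r)
    = projT2 v) by (intros u v r; now destruct r).
  pose proof (H _ _ q) as e.
  change (eq_rect x P a x (f_equal (@projT1 X P) q) = b) in e.
  now rewrite (hX x x (f_equal (@projT1 X P) q) eq_refl) in e.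
Qed.

Lemma embedding_inj {X Y : Type} {f : X -> Y} (hf : is_embedding f) {x x' : X} :
  f x = f x' -> x = x'.
Proof.
  intros p.
  exact (f_equal (@proj1_sig _ _)
           (hf (f x') (exist _ x p) (exist _ x' eq_refl))).
Qed.

Lemma inj_embedding {X Y : Type} (f : X -> Y) (hY : is_set Y) :
  (forall x x', f x = f x' -> x = x') -> is_embedding f.
Proof.
  intros hf y a b; apply sig_eq; [intros x; apply hY |].
  apply hf; transitivity y; [| symmetry]; apply proj2_sig.
Qed.

(** * Ordinals *)

(* A [Type]-valued version of [Acc]. *)
Inductive acc {X : Type} (R : X -> X -> Type) (x : X) : Type :=
  acc_intro : (forall y, R y x -> acc R y) -> acc R x.

Record Ordinal := {
  carrier :> Type;
  lt : carrier -> carrier -> Type;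
  lt_prop : forall x y, is_prop (lt x y);
  lt_trans : forall x y z, lt x y -> lt y z -> lt x z;
  lt_ext : forall x y,
    (forall z, (lt z x -> lt z y) * (lt z y -> lt z x)) -> x = y;
  lt_wf : forall x, acc lt x
}.

Arguments lt {_} _ _.
Arguments lt_prop {_ _ _} _ _.
Arguments lt_trans {_ _ _ _} _ _.
Arguments lt_ext {_ _ _} _.
Arguments lt_wf {_} _.

Record TOrd := {
  ordinal :> Ordinal;
  top : ordinal;
  top_max : forall y, lt top y -> False
}.

Arguments top {_}.
Arguments top_max {_ _} _.

Lemma lt_irrefl (t : Ordinal) (x : t) : lt x x -> False.
Proof. induction (lt_wf x) as [x _ IH]; intros h; exact (IH x h h). Qed.

Lemma ordinal_set (t : Ordinal) : is_set t.
Proof.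
  apply (is_set_of_rel t (fun x y =>
           forall z : t, ((lt z x -> lt z y) * (lt z y -> lt z x))%type)).
  - intros x y f g; extensionality z; destruct (f z), (g z).
    f_equal; extensionality h; apply lt_prop.
  - intros x z; split; exact (fun h => h).
  - exact (fun x y => lt_ext).
Qed.

Definition one : TOrd.
Proof.
  unshelve refine {| ordinal :=
    {| carrier := unit; lt := fun _ _ => Empty_set |}; top := tt |}.
  - intros _ _ [].
  - intros _ _ _ [].
  - intros [] []; reflexivity.
  - intros x; constructor; intros _ [].
  - intros _ [].
Defined.

Definition two_lt (i j : unit + unit) : Type :=
  match i, j with
  | inl _, inr _ => unit
  | _, _ => Empty_set
  end.

Definition two : TOrd.
Proof.
  unshelve refine {| ordinal :=
    {| carrier := unit + unit; lt := two_lt |}; top := inr tt |}.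
  - intros [[]|[]] [[]|[]] [] []; reflexivity.
  - intros [[]|[]] [[]|[]] [[]|[]] [] [].
  - intros [[]|[]] [[]|[]] h; try reflexivity.
    + destruct (snd (h (inl tt)) tt).
    + destruct (fst (h (inl tt)) tt).
  - assert (H : forall u, acc two_lt (inl u))
      by (intros u; constructor; intros [|] []).
    intros [u|u]; [apply H |].
    constructor; intros [v|v] h; [apply H | destruct h].
  - intros [|] [].
Defined.

Definition omega1_lt (x y : nat + unit) : Type :=
  match x, y with
  | inl m, inl n => (m < n)%nat
  | inl _, inr _ => unit
  | inr _, _ => Empty_set
  end.

Definition omega1 : TOrd.
Proof.
  unshelve refine {| ordinal :=
    {| carrier := nat + unit; lt := omega1_lt |}; top := inr tt |}.
  - intros [m|[]] [n|[]]; simpl; try (now intros []).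
    + intros p q; apply le_unique.
    + now intros [] [].
  - intros [m|[]] [n|[]] [k|[]]; simpl; try (now intros []); try easy; lia.
  - intros [m|[]] [n|[]] h; try reflexivity.
    + f_equal; pose proof (fst (h (inl n))) as h1;
        pose proof (snd (h (inl m))) as h2; simpl in *; lia.
    + pose proof (snd (h (inl m)) tt) as h1; simpl in h1; lia.
    + pose proof (fst (h (inl n)) tt) as h1; simpl in h1; lia.
  - assert (H : forall m, acc omega1_lt (inl m)).
    { intros m; induction m as [m IH] using lt_wf_rect.
      constructor; intros [k|k] h; [exact (IH k h) | destruct h]. }
    intros [m|u]; [apply H |].
    constructor; intros [k|k] h; [apply H | destruct h].
  - intros [|] [].
Defined.

(** ** Conatural numbers *)

Definition conat : Type := {u : nat -> bool | forall i, Bool.le (u (S i)) (u i)}.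

Definition bit (u : conat) (n : nat) : bool := proj1_sig u n.

Definition under (n : nat) : conat.
Proof.
  exists (fun i => i <? n).
  intros i; unfold Bool.le; destruct (Nat.ltb_spec (S i) n); [| exact I].
  apply Nat.ltb_lt; lia.
Defined.

Definition infty : conat :=
  exist (fun u => forall i, Bool.le (u (S i)) (u i))
    (fun _ => true) (fun _ => eq_refl).

Definition conat_lt (u v : conat) : Type :=
  {n : nat & ((u = under n) * (bit v n = true))%type}.

Lemma conat_eq (u v : conat) : (forall n, bit u n = bit v n) -> u = v.
Proof.
  intros h; apply sig_eq; [| extensionality n; apply h].
  intros x p q; extensionality i; revert p q; intros p q.
  generalize (p i), (q i); unfold Bool.le.
  destruct (x (S i)); [apply is_set_bool | now intros [] []].
Qed.

Lemma conat_set : is_set conat.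
Proof.
  apply (is_set_of_rel conat (fun u v => forall n, bit u n = bit v n)).
  - intros u v p q; extensionality n; apply is_set_bool.
  - reflexivity.
  - apply conat_eq.
Qed.

Lemma bit_under (n i : nat) : bit (under n) i = true <-> (i < n)%nat.
Proof. apply Nat.ltb_lt. Qed.

Lemma under_inj (m n : nat) : under m = under n -> m = n.
Proof.
  intros h; assert (H : forall i, (i < m <-> i < n)%nat)
    by (intros i; rewrite <- !bit_under, h; reflexivity).
  pose proof (H m); pose proof (H n); lia.
Qed.

Lemma under_infty (n : nat) : under n = infty -> False.
Proof.
  intros h; assert (H : bit (under n) n = true) by now rewrite h.
  apply bit_under in H; lia.
Qed.

Lemma bit_decr (u : conat) (m n : nat) :
  (m <= n)%nat -> bit u n = true -> bit u m = true.
Proof.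
  induction 1 as [| n _ IH]; [easy |]; intros h; apply IH.
  assert (H : Bool.le (bit u (S n)) (bit u n)) by apply (proj2_sig u n).
  now rewrite h in H.
Qed.

Definition Ninf : TOrd.
Proof.
  unshelve refine {| ordinal :=
    {| carrier := conat; lt := conat_lt |}; top := infty |}.
  - intros u v [n [p q]] [n' [p' q']].
    assert (e : n = n') by (apply under_inj; now rewrite <- p).
    destruct e; rewrite (conat_set _ _ p p'), (is_set_bool _ _ q q'); reflexivity.
  - intros u v w [n [p q]] [m [p' q']]; exists n; split; [exact p |].
    rewrite p' in q; apply bit_under in q.
    apply (bit_decr w n m); [lia | exact q'].
  - intros u v h; apply conat_eq; intros n; apply eq_iff_eq_true; split; intros e.
    + destruct (fst (h (under n)) (existT _ n (eq_refl, e))) as [m [p q]].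
      now rewrite (under_inj _ _ p).
    + destruct (snd (h (under n)) (existT _ n (eq_refl, e))) as [m [p q]].
      now rewrite (under_inj _ _ p).
  - assert (H : forall n, acc conat_lt (under n)).
    { intros n; induction n as [n IH] using lt_wf_rect.
      constructor; intros w [m [p q]]; rewrite p.
      apply IH, bit_under, q. }
    intros u; constructor; intros w [m [p _]]; rewrite p; apply H.
  - intros y [n [p _]]; symmetry in p; exact (under_infty n p).
Defined.

Definition iota1 (x : omega1) : Ninf :=
  match x with
  | inl n => under n
  | inr _ => infty
  end.

Lemma iota1_embedding : is_embedding iota1.
Proof.
  apply inj_embedding; [apply conat_set |].
  intros [m|[]] [n|[]]; simpl; intros h.
  - f_equal; now apply under_inj.
  - destruct (under_infty m h).
  - symmetry in h; destruct (under_infty n h).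
  - reflexivity.
Qed.

(** ** Lexicographic sums *)

Definition sum_lt (t : TOrd) (u : t -> TOrd) (z z' : {x : t & u x}) : Type :=
  (lt (projT1 z) (projT1 z') +
   {r : projT1 z = projT1 z' &
     lt (eq_rect (projT1 z) u (projT2 z) (projT1 z') r) (projT2 z')})%type.

Lemma sum_lt_prop t u z z' : is_prop (sum_lt t u z z').
Proof.
  destruct z as [x a], z' as [y b].
  intros [h|[r h]] [h'|[r' h']]; simpl in *.
  - f_equal; apply lt_prop.
  - exfalso; destruct r'; exact (lt_irrefl _ _ h).
  - exfalso; destruct r; exact (lt_irrefl _ _ h').
  - f_equal; apply sigT_eq; [intros; apply lt_prop | apply ordinal_set].
Qed.

Lemma sum_lt_trans t u z1 z2 z3 :
  sum_lt t u z1 z2 -> sum_lt t u z2 z3 -> sum_lt t u z1 z3.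
Proof.
  destruct z1 as [x a], z2 as [y b], z3 as [z c].
  intros [h|[r h]] [h'|[r' h']]; simpl in *.
  - left; exact (lt_trans h h').
  - destruct r'; left; exact h.
  - destruct r; left; exact h'.
  - destruct r, r'; right; exists eq_refl; exact (lt_trans h h').
Qed.

Lemma sum_lt_ext t u z z' :
  (forall w, (sum_lt t u w z -> sum_lt t u w z') *
             (sum_lt t u w z' -> sum_lt t u w z)) -> z = z'.
Proof.
  destruct z as [x a], z' as [y b]; intros h.
  assert (e : x = y).
  { apply lt_ext; intros w; destruct (h (existT _ w top)) as [f g]; split; intros l.
    - destruct (f (inl l)) as [l'|[r l']]; [exact l' |]; simpl in *.
      destruct r; destruct (top_max l').
    - destruct (g (inl l)) as [l'|[r l']]; [exact l' |]; simpl in *.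
      destruct r; destruct (top_max l'). }
  destruct e; f_equal; apply lt_ext; intros w.
  assert (H : forall c d : u x,
    sum_lt t u (existT _ x c) (existT _ x d) -> lt c d).
  { intros c d [l|[r l]]; simpl in *; [destruct (lt_irrefl _ _ l) |].
    now rewrite (ordinal_set _ _ _ r eq_refl) in l. }
  destruct (h (existT _ x w)) as [f g]; split; intros l; apply H.
  - apply f; right; exists eq_refl; exact l.
  - apply g; right; exists eq_refl; exact l.
Qed.

Lemma sum_lt_wf t u z : acc (sum_lt t u) z.
Proof.
  destruct z as [x a]; revert a; induction (lt_wf x) as [x _ IHx]; intros a.
  induction (lt_wf a) as [a _ IHa]; constructor; intros [y b] [l|[r l]];
    simpl in *; [exact (IHx y l b) |].
  revert l; destruct r; simpl; apply IHa.
Qed.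

Definition osum (t : TOrd) (u : t -> TOrd) : TOrd.
Proof.
  refine {| ordinal :=
    {| carrier := {x : t & u x};
       lt := sum_lt t u;
       lt_prop := sum_lt_prop t u;
       lt_trans := sum_lt_trans t u;
       lt_ext := sum_lt_ext t u;
       lt_wf := sum_lt_wf t u |};
    top := existT _ top top |}.
  intros [y b] [l|[r l]]; simpl in *; [exact (top_max l) |].
  destruct r; exact (top_max l).
Defined.

Definition two_fam (t u : TOrd) (i : two) : TOrd :=
  match i with
  | inl _ => t
  | inr _ => u
  end.

Definition oplus (t u : TOrd) : TOrd := osum two (two_fam t u).

Definition otimes (t u : TOrd) : TOrd := osum t (fun _ => u).

(** ** Extension of a family along an embedding *)

Definition ext_fun {X K : Type} (j : X -> K) (a : X -> TOrd) (k : K) : Type :=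
  forall p : fiber j k, a (proj1_sig p).

Definition ext_lt {X K : Type} (j : X -> K) (a : X -> TOrd) (k : K)
  (u v : ext_fun j a k) : Type := {p : fiber j k & lt (u p) (v p)}.

Lemma ext_lt_ext {X K : Type} (j : X -> K) (hj : is_embedding j)
  (a : X -> TOrd) (k : K) (u v : ext_fun j a k) :
  (forall w, (ext_lt j a k w u -> ext_lt j a k w v) *
             (ext_lt j a k w v -> ext_lt j a k w u)) -> u = v.
Proof.
  intros h; extensionality p; apply lt_ext; intros c.
  set (w := fun q => eq_rect p (fun q => carrier (a (proj1_sig q))) c q
                       (hj k p q)).
  assert (e : w p = c).
  { unfold w; now rewrite (is_set_of_prop _ (hj k) p p (hj k p p) eq_refl). }
  rewrite <- e; destruct (h w) as [f g]; split; intros l.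
  - destruct (f (existT _ p l)) as [q l']; now destruct (hj k q p).
  - destruct (g (existT _ p l)) as [q l']; now destruct (hj k q p).
Qed.

Lemma ext_lt_wf {X K : Type} (j : X -> K) (hj : is_embedding j)
  (a : X -> TOrd) (k : K) (u : ext_fun j a k) : acc (ext_lt j a k) u.
Proof.
  assert (H : forall (p : fiber j k) (c : a (proj1_sig p)) (v : ext_fun j a k),
    v p = c -> acc (ext_lt j a k) v).
  { intros p c; induction (lt_wf c) as [c _ IH]; intros v e.
    constructor; intros w [q l]; apply (IH (w p)); [| reflexivity].
    rewrite <- e; now destruct (hj k q p). }
  constructor; intros w [p _]; exact (H p _ w eq_refl).
Qed.

Definition ext {X K : Type} (j : X -> K) (hj : is_embedding j)
  (a : X -> TOrd) (k : K) : TOrd.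
Proof.
  unshelve refine {| ordinal :=
    {| carrier := ext_fun j a k;
       lt := ext_lt j a k;
       lt_ext := ext_lt_ext j hj a k;
       lt_wf := ext_lt_wf j hj a k |};
    top := fun p => top |}.
  - intros u v; intros [p l] [q l']; apply sigT_eq; [intros; apply lt_prop |].
    apply hj.
  - intros u v w [p l] [q l']; exists p; apply (lt_trans l).
    now destruct (hj k q p).
  - intros v [p l]; exact (top_max l).
Defined.

Definition phi {X K : Type} {j : X -> K} {hj : is_embedding j} {a : X -> TOrd}
  (x : X) (u : ext j hj a (j x)) : a x := u (exist _ x eq_refl).

Definition phi_inv {X K : Type} {j : X -> K} {hj : is_embedding j}
  {a : X -> TOrd} (x : X) (c : a x) : ext j hj a (j x) :=
  fun p => eq_rect (exist _ x eq_refl) (fun p => carrier (a (proj1_sig p))) c p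
             (hj (j x) (exist _ x eq_refl) p).

Lemma phi_phi_inv {X K : Type} {j : X -> K} {hj : is_embedding j}
  {a : X -> TOrd} (x : X) (c : a x) : phi x (phi_inv (hj := hj) (a := a) x c) = c.
Proof.
  unfold phi, phi_inv; set (p := exist _ x eq_refl : fiber j (j x)).
  now rewrite (is_set_of_prop _ (hj (j x)) p p (hj (j x) p p) eq_refl).
Qed.

Lemma phi_inv_phi {X K : Type} {j : X -> K} {hj : is_embedding j}
  {a : X -> TOrd} (x : X) (u : ext j hj a (j x)) : phi_inv x (phi x u) = u.
Proof.
  unfold phi, phi_inv; extensionality p.
  now destruct (hj (j x) (exist _ x eq_refl) p).
Qed.

Lemma phi_lt {X K : Type} {j : X -> K} {hj : is_embedding j}
  {a : X -> TOrd} (x : X) (u v : ext j hj a (j x)) :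
  ((lt u v -> lt (phi x u) (phi x v)) * (lt (phi x u) (phi x v) -> lt u v))%type.
Proof.
  unfold phi; split.
  - intros [p l].
    assert (H : forall q, lt (u q) (v q))
      by (intros q; now destruct (hj (j x) p q)).
    exact (H (exist _ x eq_refl)).
  - intros l; exact (existT _ (exist _ x eq_refl : fiber j (j x)) l).
Qed.

(** * Codes *)

(** The inductive-recursive definition of [(E, Delta)] is rendered as an
    inductive family indexed by the decoded ordinal: [Code t] is the type of
    codes that decode to [t].  The constructors of [E], the equations for
    [Delta] (which hold by computation) and the induction principle of [E] are
    derived below. *)
Inductive Code : TOrd -> Type :=
| Cone : Code one
| Comega1 : Code omega1
| Cplus : forall t u, Code t -> Code u -> Code (oplus t u)
| Ctimes : forall t u, Code t -> Code u -> Code (otimes t u)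
| Csum : forall (t : TOrd) (u : t -> TOrd),
    Code t -> (forall x : t, Code (u x)) -> Code (osum t u).

Arguments Cplus {t u} _ _.
Arguments Ctimes {t u} _ _.
Arguments Csum {t u} _ _.

Definition E : Type := {t : TOrd & Code t}.

Definition Delta (nu : E) : TOrd := projT1 nu.

Definition code (nu : E) : Code (Delta nu) := projT2 nu.

Definition Eone : E := existT _ _ Cone.
Definition Eomega1 : E := existT _ _ Comega1.
Definition Eplus (nu0 nu1 : E) : E := existT _ _ (Cplus (code nu0) (code nu1)).
Definition Etimes (nu0 nu1 : E) : E := existT _ _ (Ctimes (code nu0) (code nu1)).
Definition Esum (nu : E) (A : Delta nu -> E) : E :=
  existT _ _ (Csum (code nu) (fun x => code (A x))).

Definition E_rect (P : E -> Type)
  (h1 : P Eone) (homega1 : P Eomega1)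
  (hplus : forall nu0 nu1, P nu0 -> P nu1 -> P (Eplus nu0 nu1))
  (htimes : forall nu0 nu1, P nu0 -> P nu1 -> P (Etimes nu0 nu1))
  (hsum : forall nu (A : Delta nu -> E),
      P nu -> (forall x, P (A x)) -> P (Esum nu A))
  (nu : E) : P nu :=
  match nu with
  | existT _ t c =>
    Code_rect (fun t c => P (existT _ t c)) h1 homega1
      (fun t u c IHc d IHd => hplus (existT _ t c) (existT _ u d) IHc IHd)
      (fun t u c IHc d IHd => htimes (existT _ t c) (existT _ u d) IHc IHd)
      (fun t u c IHc d IHd =>
         hsum (existT _ t c) (fun x => existT _ (u x) (d x)) IHc IHd)
      t c
  end.

Example Delta_one : Delta Eone = one := eq_refl.
Example Delta_omega1 : Delta Eomega1 = omega1 := eq_refl.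
Example Delta_plus nu0 nu1 :
  Delta (Eplus nu0 nu1) = oplus (Delta nu0) (Delta nu1) := eq_refl.
Example Delta_times nu0 nu1 :
  Delta (Etimes nu0 nu1) = osum (Delta nu0) (fun _ => Delta nu1) := eq_refl.
Example Delta_sum nu A :
  Delta (Esum nu A) = osum (Delta nu) (fun x => Delta (A x)) := eq_refl.

(** * The ordinals [K nu] and the embeddings [iota nu] *)

Record Target (t : TOrd) := {
  target : TOrd;
  arrow : t -> target;
  arrow_embedding : is_embedding arrow
}.

Arguments target {t} _.
Arguments arrow {t} _ _.
Arguments arrow_embedding {t} _ _ _ _.

Definition plus_map {t u t' u' : TOrd} (f : t -> t') (g : u -> u')
  (z : oplus t u) : oplus t' u' :=
  match z with
  | existT _ i y =>
    match i return two_fam t u i -> oplus t' u' with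
    | inl _ => fun y => existT (two_fam t' u') (inl tt) (f y)
    | inr _ => fun y => existT (two_fam t' u') (inr tt) (g y)
    end y
  end.

Definition times_map {t u t' u' : TOrd} (f : t -> t') (g : u -> u')
  (z : otimes t u) : otimes t' u' :=
  existT _ (f (projT1 z)) (g (projT2 z)).

Definition sum_map {t t' : TOrd} {u u' : t -> TOrd} (f : t -> t')
  (hf : is_embedding f) (g : forall x, u x -> u' x) (z : osum t u) :
  osum t' (ext f hf u') :=
  existT _ (f (projT1 z))
    (phi_inv (hj := hf) (projT1 z) (g (projT1 z) (projT2 z))).

Lemma plus_map_embedding {t u t' u' : TOrd} (f : t -> t') (g : u -> u') :
  is_embedding f -> is_embedding g -> is_embedding (plus_map f g).
Proof.
  intros hf hg; apply inj_embedding; [apply ordinal_set |].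
  intros [[[]|[]] y] [[[]|[]] y'] e; simpl in *.
  - f_equal; apply (embedding_inj hf).
    exact (pair2_inj (ordinal_set two) (P := two_fam t' u') e).
  - discriminate (f_equal (@projT1 _ _) e).
  - discriminate (f_equal (@projT1 _ _) e).
  - f_equal; apply (embedding_inj hg).
    exact (pair2_inj (ordinal_set two) (P := two_fam t' u') e).
Qed.

Lemma times_map_embedding {t u t' u' : TOrd} (f : t -> t') (g : u -> u') :
  is_embedding f -> is_embedding g -> is_embedding (times_map f g).
Proof.
  intros hf hg; apply inj_embedding; [apply ordinal_set |].
  intros [x y] [x' y'] e; unfold times_map in e; simpl in *.
  destruct (embedding_inj hf (f_equal (@projT1 _ _) e)).
  f_equal; apply (embedding_inj hg).
  exact (pair2_inj (ordinal_set t') (P := fun _ => u') e).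
Qed.

Lemma sum_map_embedding {t t' : TOrd} {u u' : t -> TOrd} (f : t -> t')
  (hf : is_embedding f) (g : forall x, u x -> u' x) :
  (forall x, is_embedding (g x)) -> is_embedding (sum_map f hf g).
Proof.
  intros hg; apply inj_embedding; [apply ordinal_set |].
  intros [x y] [x' y'] e; unfold sum_map in e; simpl in *.
  destruct (embedding_inj hf (f_equal (@projT1 _ _) e)).
  f_equal; apply (embedding_inj (hg x)).
  rewrite <- (phi_phi_inv (hj := hf) (a := u') x (g x y)).
  rewrite <- (phi_phi_inv (hj := hf) (a := u') x (g x y')).
  f_equal; exact (pair2_inj (ordinal_set t') (P := ext f hf u') e).
Qed.

Fixpoint interp {t : TOrd} (c : Code t) : Target t :=
  match c in Code t return Target t with
  | Cone =>
    {| target := one;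
       arrow := fun x => x;
       arrow_embedding :=
         inj_embedding (fun x : one => x) (ordinal_set one) (fun _ _ e => e) |}
  | Comega1 =>
    {| target := Ninf;
       arrow := iota1;
       arrow_embedding := iota1_embedding |}
  | Cplus c d =>
    {| target := oplus (target (interp c)) (target (interp d));
       arrow := plus_map (arrow (interp c)) (arrow (interp d));
       arrow_embedding := plus_map_embedding _ _
         (arrow_embedding (interp c)) (arrow_embedding (interp d)) |}
  | Ctimes c d =>
    {| target := otimes (target (interp c)) (target (interp d));
       arrow := times_map (arrow (interp c)) (arrow (interp d));
       arrow_embedding := times_map_embedding _ _
         (arrow_embedding (interp c)) (arrow_embedding (interp d)) |}
  | Csum c d =>
    {| target := osum (target (interp c))
         (ext (arrow (interp c)) (arrow_embedding (interp c))
            (fun x => target (interp (d x))));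
       arrow := sum_map (arrow (interp c)) (arrow_embedding (interp c))
         (fun x => arrow (interp (d x)));
       arrow_embedding := sum_map_embedding _ (arrow_embedding (interp c)) _
         (fun x => arrow_embedding (interp (d x))) |}
  end.

Definition K (nu : E) : TOrd := target (interp (code nu)).

Definition iota (nu : E) : Delta nu -> K nu := arrow (interp (code nu)).

Definition iota_embedding (nu : E) : is_embedding (iota nu) :=
  arrow_embedding (interp (code nu)).

Example K_one : K Eone = one := eq_refl.
Example K_omega1 : K Eomega1 = Ninf := eq_refl.
Example K_plus nu0 nu1 : K (Eplus nu0 nu1) = oplus (K nu0) (K nu1) := eq_refl.
Example K_times nu0 nu1 :
  K (Etimes nu0 nu1) = osum (K nu0) (fun _ => K nu1) := eq_refl.
Example K_sum nu A :
  K (Esum nu A)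
  = osum (K nu) (ext (iota nu) (iota_embedding nu) (fun x => K (A x))) := eq_refl.

Example iota_one x : iota Eone x = x := eq_refl.
Example iota_omega1 x : iota Eomega1 x = iota1 x := eq_refl.
Example iota_plus_l nu0 nu1 y :
  iota (Eplus nu0 nu1) (existT _ (inl tt) y) = existT _ (inl tt) (iota nu0 y)
  := eq_refl.
Example iota_plus_r nu0 nu1 y :
  iota (Eplus nu0 nu1) (existT _ (inr tt) y) = existT _ (inr tt) (iota nu1 y)
  := eq_refl.
Example iota_times nu0 nu1 x y :
  iota (Etimes nu0 nu1) (existT _ x y) = existT _ (iota nu0 x) (iota nu1 y)
  := eq_refl.
Example iota_sum nu A x z :
  iota (Esum nu A) (existT _ x z)
  = existT _ (iota nu x)
      (phi_inv (hj := iota_embedding nu) (a := fun x => K (A x)) x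
         (iota (A x) z)) := eq_refl.

(** * The limit point indicator *)

Fixpoint indicator {t : TOrd} (c : Code t) : t -> bool :=
  match c in Code t return t -> bool with
  | Cone => fun _ => false
  | Comega1 => fun x =>
    match x with
    | inl _ => false
    | inr _ => true
    end
  | @Cplus t u c d => fun z =>
    match z with
    | existT _ i y =>
      match i return two_fam t u i -> bool with
      | inl _ => indicator c
      | inr _ => indicator d
      end y
    end
  | Ctimes c d => fun z => indicator c (projT1 z) || indicator d (projT2 z)
  | Csum c d => fun z =>
    indicator c (projT1 z) || indicator (d (projT1 z)) (projT2 z)
  end.

Definition ell (nu : E) : Delta nu -> bool := indicator (code nu).

Example ell_one : ell Eone tt = false := eq_refl.
Example ell_omega1_l n : ell Eomega1 (inl n) = false := eq_refl.
Example ell_omega1_r : ell Eomega1 (inr tt) = true := eq_refl.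
Example ell_plus_l nu0 nu1 y :
  ell (Eplus nu0 nu1) (existT _ (inl tt) y) = ell nu0 y := eq_refl.
Example ell_plus_r nu0 nu1 y :
  ell (Eplus nu0 nu1) (existT _ (inr tt) y) = ell nu1 y := eq_refl.
Example ell_times nu0 nu1 x y :
  ell (Etimes nu0 nu1) (existT _ x y) = ell nu0 x || ell nu1 y := eq_refl.
Example ell_sum nu A x z :
  ell (Esum nu A) (existT _ x z) = ell nu x || ell (A x) z := eq_refl.

(* Main.v *)
Require Import Defs.
From Stdlib Require Import Bool Arith Lia.

(** The indicator computes which alternative holds, so everything follows from
    one induction on codes: [iota nu x] is a limit point or isolated according
    to whether [ell nu x] is 1 or 0.

    In [Ninf] a finite point is recognised by inspecting one or two bits, while
    deciding equality with [infty] amounts to deciding whether a decreasing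
    binary sequence is constantly 1; any binary sequence can be made decreasing
    by taking running conjunctions, which gives WLPO.

    For the three sums, the matter is how isolatedness of a pair [(x, a)]
    relates to isolatedness of its components ([status_pair]).  If both
    components are isolated then so is the pair, and if the pair is isolated
    then so is [a], because the base is a set.  Isolatedness of [x] is the
    delicate point: to decide [x = k] one has to compare [(x, a)] with a pair
    over [k] whose second component is [a] in case [k] happens to be [x].  This
    needs a section of the family through [a].  For products the constant
    section serves, and for binary sums the base is decidable.  For
    [Esum nu A] the family [ext (iota nu) _ (K o A)] consists of functions on
    fibers of [iota nu], so a section is obtained by restriction from a section of [K o A] over [Delta nu].  That one exists
    because [Delta nu], unlike [K nu] in general, has decidable equality
    ([Delta_discrete]): take the prescribed value at the given point and the top
    everywhere else ([section_through]). *)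

(** * Isolated points *)

Definition discrete (X : Type) : Type := forall x : X, isolated x.

Lemma isolated_of_injective {X Y : Type} (f : X -> Y)
  (hf : forall x x', f x = f x' -> x = x') (x : X) :
  isolated (f x) -> isolated x.
Proof.
  intros h x'; destruct (h (f x')) as [e|n].
  - left; exact (hf _ _ e).
  - right; intros e; apply n; now rewrite e.
Qed.

Lemma isolated_pair {X : Type} {P : X -> Type} (hX : is_set X) (x : X) (a : P x) :
  isolated x -> isolated a -> isolated (existT P x a).
Proof.
  intros hx ha [k b]; destruct (hx k) as [e|n].
  - destruct e; destruct (ha b) as [e|n].
    + left; now rewrite e.
    + right; intros e; exact (n (pair2_inj hX e)).
  - right; intros e; exact (n (f_equal (@projT1 _ _) e)).
Qed.

Lemma isolated_snd {X : Type} {P : X -> Type} (hX : is_set X) (x : X) (a : P x) :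
  isolated (existT P x a) -> isolated a.
Proof. apply isolated_of_injective; intros b c; apply (pair2_inj hX). Qed.

(** The section moves along with [k], so that [(x, s x)] and [(k, s k)] differ
    only if [x] and [k] do; without it the second components could be what
    makes the pairs differ. *)
Lemma isolated_fst {X : Type} {P : X -> Type} (s : forall k, P k) (x : X) :
  isolated (existT P x (s x)) -> isolated x.
Proof.
  apply (isolated_of_injective (fun k => existT P k (s k))).
  intros k k' e; exact (f_equal (@projT1 _ _) e).
Qed.

Lemma section_through {X : Type} {P : X -> Type} (hX : is_set X)
  (s0 : forall k, P k) (x : X) (hx : isolated x) (a : P x) :
  {s : forall k, P k & s x = a}.
Proof.
  exists (fun k => match hx k with
                   | inl r => eq_rect x P a k r
                   | inr _ => s0 k
                   end).
  destruct (hx x) as [r|n].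
  - now rewrite (hX x x r eq_refl).
  - destruct (n eq_refl).
Qed.

Lemma discrete_osum (t : TOrd) (u : t -> TOrd) :
  discrete t -> (forall x, discrete (u x)) -> discrete (osum t u).
Proof.
  intros ht hu [x a]; exact (isolated_pair (ordinal_set t) x a (ht x) (hu x a)).
Qed.

Lemma two_discrete : discrete two.
Proof.
  intros [[]|[]] [[]|[]]; (left; reflexivity) || (right; discriminate).
Qed.

Lemma omega1_discrete : discrete omega1.
Proof.
  intros [m|[]] [n|[]].
  - destruct (Nat.eq_dec m n) as [e|ne]; [left; now f_equal |].
    right; intros e; apply ne; now injection e.
  - right; discriminate.
  - right; discriminate.
  - left; reflexivity.
Qed.

Lemma Delta_discrete (nu : E) : discrete (Delta nu).
Proof.
  induction nu as [| | nu0 nu1 IH0 IH1 | nu0 nu1 IH0 IH1 | nu A IH IHA]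
    using E_rect.
  - intros [] []; left; reflexivity.
  - exact omega1_discrete.
  - apply discrete_osum; [exact two_discrete | intros [|]; assumption].
  - apply discrete_osum; [assumption | intros _; assumption].
  - apply discrete_osum; assumption.
Qed.

(** * Points of the conatural numbers *)

Lemma eq_under (n : nat) (v : conat) :
  (forall i, i < n -> bit v i = true) -> bit v n = false -> under n = v.
Proof.
  intros h1 h0; apply conat_eq; intros i.
  destruct (bit (under n) i) eqn:e; symmetry.
  - apply h1, bit_under, e.
  - destruct (bit v i) eqn:e'; [exfalso | reflexivity].
    destruct (Nat.lt_ge_cases i n) as [l|l].
    + apply bit_under in l; congruence.
    + pose proof (bit_decr v n i l e'); congruence.
Qed.

(** Bits decrease, so bits [n - 1] and [n] decide whether a conatural number
    is [under n]. *)
Lemma under_isolated (n : nat) : isolated (under n).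
Proof.
  intros v; destruct (bit v n) eqn:e0.
  { right; intros e; rewrite <- e in e0; apply bit_under in e0; lia. }
  destruct n as [|n].
  { left; apply eq_under; [lia | exact e0]. }
  destruct (bit v n) eqn:e1.
  - left; apply eq_under; [| exact e0].
    intros i l; apply (bit_decr v i n); [lia | exact e1].
  - right; intros e; assert (H : bit (under (S n)) n = true)
      by (apply bit_under; lia).
    rewrite e in H; congruence.
Qed.

Fixpoint all_upto (p : nat -> bool) (n : nat) : bool :=
  match n with
  | 0 => p 0
  | S m => p (S m) && all_upto p m
  end.

Definition running_min (p : nat -> bool) : conat.
Proof.
  exists (all_upto p).
  intros i; simpl; destruct (p (S i)), (all_upto p i); easy.
Defined.

Lemma running_min_infty (p : nat -> bool) :
  infty = running_min p <-> (forall n, p n = true).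
Proof.
  split.
  - intros e n.
    assert (H : all_upto p n = true)
      by exact (f_equal (fun u => bit u n) (eq_sym e)).
    destruct n as [|n]; [exact H |]; simpl in H.
    apply andb_prop in H; exact (proj1 H).
  - intros h; apply conat_eq; intros n; symmetry.
    change (all_upto p n = true).
    induction n as [|n IH]; simpl; [apply h | now rewrite h, IH].
Qed.

Lemma infty_limit_point : limit_point infty.
Proof.
  intros h p; destruct (h (running_min p)) as [e|n].
  - left; apply running_min_infty, e.
  - right; intros e; apply n, running_min_infty, e.
Qed.

(** * The indicator decides the status of a point *)

Definition status {X : Type} (b : bool) (x : X) : Type :=
  if b then limit_point x else isolated x.

(** Isolatedness passes from the pair to each component, so a pair is a limit
    point as soon as one component is.  The section is what yields this for the
    first component. *)
Lemma status_pair {X : Type} {P : X -> Type} (hX : is_set X) (b c : bool)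
  (s : forall k, P k) (x : X) :
  status b x -> status c (s x) -> status (b || c) (existT P x (s x)).
Proof.
  destruct b; [| destruct c]; simpl; intros hx ha.
  - intros h; apply hx, (isolated_fst s), h.
  - intros h; apply ha, (isolated_snd hX), h.
  - apply (isolated_pair hX); assumption.
Qed.

Lemma status_plus (t u : TOrd) (i : two) (a : two_fam t u i) (b : bool) :
  status b a -> status b (existT (two_fam t u) i a : oplus t u).
Proof.
  intros ha.
  destruct (section_through (P := two_fam t u) (ordinal_set two)
              (fun _ => top) i (two_discrete i) a) as [s e].
  rewrite <- e in ha |- *.
  exact (status_pair (ordinal_set two) false b s i (two_discrete i) ha).
Qed.

(** Evaluation [phi] and its inverse are both injective, so a value and its
    extension have the same status. *)
Lemma status_phi_inv {X Y : Type} {j : X -> Y} (hj : is_embedding j)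
  (a : X -> TOrd) (x : X) (c : a x) (b : bool) :
  status b c -> status b (phi_inv (hj := hj) (a := a) x c).
Proof.
  destruct b; simpl.
  - intros hc h; apply hc; revert h.
    apply (isolated_of_injective (phi_inv (hj := hj) (a := a) x)).
    intros d d' e; rewrite <- (phi_phi_inv (hj := hj) (a := a) x d), e.
    apply phi_phi_inv.
  - intros hc; apply (isolated_of_injective (phi (hj := hj) (a := a) x)).
    + intros u v e; rewrite <- (phi_inv_phi (hj := hj) (a := a) x u), e.
      apply phi_inv_phi.
    + now rewrite phi_phi_inv.
Qed.

(** A section [s] of [a] through [c] restricts to every fiber of [j]; over
    [j x] the restriction is the extension of [c]. *)
Lemma ext_section_through {X Y : Type} {j : X -> Y} (hj : is_embedding j)
  (a : X -> TOrd) (hX : is_set X) (x : X) (hx : isolated x) (c : a x) :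
  {s : forall k, ext j hj a k & s (j x) = phi_inv (hj := hj) (a := a) x c}.
Proof.
  destruct (section_through (P := fun x => a x) hX (fun _ => top) x hx c)
    as [s e].
  exists (fun k (p : fiber j k) => s (proj1_sig p)).
  rewrite <- e; symmetry.
  exact (phi_inv_phi (hj := hj) (a := a) x (fun p => s (proj1_sig p))).
Qed.

Lemma ell_status (nu : E) : forall x : Delta nu, status (ell nu x) (iota nu x).
Proof.
  induction nu as [| | nu0 nu1 IH0 IH1 | nu0 nu1 IH0 IH1 | nu A IH IHA]
    using E_rect.
  - intros [] []; left; reflexivity.
  - intros [n|[]]; [exact (under_isolated n) | exact infty_limit_point].
  - intros [[[]|[]] y].
    + exact (status_plus (K nu0) (K nu1) (inl tt) _ _ (IH0 y)).
    + exact (status_plus (K nu0) (K nu1) (inr tt) _ _ (IH1 y)).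
  - intros [x y].
    exact (status_pair (ordinal_set (K nu0)) _ _ (fun _ => iota nu1 y) _
             (IH0 x) (IH1 y)).
  - intros [x z].
    pose proof (status_phi_inv (iota_embedding nu) (fun x => K (A x)) x _ _
                  (IHA x z)) as hz.
    destruct (ext_section_through (iota_embedding nu) (fun x => K (A x))
                (ordinal_set (Delta nu)) x (Delta_discrete nu x)
                (iota (A x) z)) as [s e].
    rewrite <- e in hz.
    pose proof (status_pair (ordinal_set (K nu)) _ _ s _ (IH x) hz) as h.
    rewrite e in h; exact h.
Qed.

Theorem theorem7p16 (nu : E) :
  ((forall x : Delta nu, ell nu x = false -> isolated (iota nu x)) *
   (forall x : Delta nu, ell nu x = true -> limit_point (iota nu x)) *
   (forall y : K nu, in_image (iota nu) y -> isolated y + limit_point y) *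
   ((WLPO -> False) ->
      forall x : Delta nu, decidable (isolated (iota nu x))))%type.
Proof.
  repeat split.
  - intros x e; pose proof (ell_status nu x) as h; now rewrite e in h.
  - intros x e; pose proof (ell_status nu x) as h; now rewrite e in h.
  - intros y hy.
    (* The fibers of an embedding are propositions, so a preimage can be
       extracted from the truncation although the goal is not a proposition. *)
    destruct (embedding_in_image _ (iota_embedding nu) y hy) as [x e].
    destruct e; pose proof (ell_status nu x) as h.
    destruct (ell nu x); [right | left]; exact h.
  - intros nw x; pose proof (ell_status nu x) as h.
    destruct (ell nu x); [right; intros i; exact (nw (h i)) | left; exact h].
Qed.
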